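(* Let $a,b\ge1$ be integers, $g=\gcd(a,b)$, and let $I\in\mathcal I^1_{a,b}$. Then $r(I)=g-1$ if and only if either $g=1$ and $I=(x^a,y^b)$, or $$I=(x^a,\;x^{e(a/g)}y^{b-e(b/g)},\;y^b)$$ for some integer $e\in[1,g-1]$ with $\gcd(e,g)=1$.
   Context: $K$ is a field. For a monomial ideal $I\subset K[x,y]$, $G(I)$ is its unique minimal set of monomial generators. $\mathcal I^1_{a,b}$ is the set of monomial ideals $I\subset K[x,y]$ with $x^a,y^b\in G(I)$ and $bc+ad=ab$ for all $x^cy^d\in G(I)$. With $J=(x^a,y^b)$, the reduction number $r(I)$ of $I\in\mathcal I^1_{a,b}$ is the smallest integer $r\ge0$ with $I^{r+1}=JI^r$ (such $r$ exists). $[c,d]$ denotes the set of integers $i$ with $c\le i\le d$. *)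

(* Defs.v *)
From HB Require Import structures.
From mathcomp Require Import all_boot all_algebra.
From mathcomp Require Import mpoly.

Set Implicit Arguments.
Unset Strict Implicit.
Unset Printing Implicit Defensive.

Import GRing.Theory.

Local Open Scope ring_scope.

Section Ideals.

Variable R : comNzRingType.

(* Ideals are Prop-valued sets, so equality of ideals is extensional. *)
Definition set_eq (I J : R -> Prop) : Prop := forall f, I f <-> J f.

Definition ideal_gen (S : R -> Prop) : R -> Prop := fun f =>
  exists (n : nat) (c s : 'I_n -> R),
    (forall i, S (s i)) /\ f = \sum_(i < n) c i * s i.

Definition ideal_seq (s : seq R) : R -> Prop := ideal_gen (fun u => u \in s).

Definition ideal_mul (I J : R -> Prop) : R -> Prop :=
  ideal_gen (fun f => exists u v : R, I u /\ J v /\ f = u * v).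

Definition ideal_exp (I : R -> Prop) (r : nat) : R -> Prop :=
  iter r (ideal_mul I) (fun _ => True).

(* "The reduction number of I with respect to J is r", as a relation: this
   avoids a default value when no such exponent exists. *)
Definition is_reduction_number (J I : R -> Prop) (r : nat) : Prop :=
  set_eq (ideal_exp I r.+1) (ideal_mul J (ideal_exp I r)) /\
  (forall s : nat, set_eq (ideal_exp I s.+1) (ideal_mul J (ideal_exp I s)) ->
     (r <= s)%N).

End Ideals.

Section MonomialIdeals.

Variable K : fieldType.

Definition mon (c d : nat) : {mpoly K[2]} :=
  'X_(0 : 'I_2) ^+ c * 'X_(1 : 'I_2) ^+ d.

(* G is a minimal set of monomial generators of I, minimal for inclusion. Every
   monomial ideal has exactly one such G. *)
Definition is_min_mon_gens (I G : {mpoly K[2]} -> Prop) : Prop :=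
  [/\ forall u, G u -> exists c d : nat, u = mon c d,
      set_eq I (ideal_gen G)
    & forall H : {mpoly K[2]} -> Prop,
        (forall u, H u -> G u) -> set_eq I (ideal_gen H) ->
        forall u, G u -> H u].

(* That I is a monomial ideal is part of the existence of G. *)
Definition class_I1 (a b : nat) (I : {mpoly K[2]} -> Prop) : Prop :=
  exists G : {mpoly K[2]} -> Prop,
    [/\ is_min_mon_gens I G, G (mon a 0), G (mon 0 b)
      & forall c d : nat, G (mon c d) -> (b * c + a * d = a * b)%N].

End MonomialIdeals.

(* Main.v *)
Require Import Defs.
From HB Require Import structures.
From mathcomp Require Import all_boot all_algebra.
From mathcomp Require Import mpoly.
From mathcomp Require Import zify.
From Stdlib Require Import Classical.

(** Put [p = a / g] and [q = b / g].  Since [p] and [q] are coprime, the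
    monomials on the segment [b c + a d = a b] are [x^(k p) y^((g - k) q)] with
    [0 <= k <= g], so the ideal [I] is encoded by a set [S] of integers with
    [0, g \in S] and [S] contained in [0, g].  The power [I^n] is generated by
    the monomials of weighted degree [n a b] indexed by the [n]-fold sumset
    [nS]; monomials of the same weighted degree divide each other only when
    they are equal, so that [I^(n+1) = J I^n] says exactly that
    [(n+1)S = {0, g} + nS] ([power_eq_iff_stable]).

    It remains to find the [S] for which this equality of sumsets first holds
    at [n = g - 1] ([maximal_reduction_sumset]).  If it fails at [n], some sum
    of [n + 1] elements of [S] cannot be rewritten as a sum of [n + 1] elements
    of [S] using [0] or [g]; call the word of its summands irreducible.  The
    key remark ([irreducible_sum_neq]) is that an irreducible word of length at
    least 2 has a sum congruent modulo [g] to no element of [S]: a congruence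
    with [f] would let us replace the word by [f], some copies of [g] and some
    copies of [0].  As factors of irreducible words are irreducible, the prefix
    sums of an irreducible word are pairwise distinct modulo [g], whence its
    length is less than [g] and the equality does hold at [g - 1].  This settles
    [g = 1], where [S = {0, 1}]; let [g > 1].  An irreducible word of length [g - 1] has prefix sums meeting every residue;
    the residue of an [f] in [S] with [0 < f < g] can only be met by the prefix
    of length 1, so [f] is the first letter [e] of the word.  Hence
    [S = {0, e, g}], and [e] is prime to [g] because the multiples
    [e, 2e, ..., (g-1)e] are nonzero modulo [g].  Conversely, for such an [S]
    the sum [(n+1)e] with [n + 1 < g] is congruent to no [c e] with [c <= n],
    hence does not lie in [{0, g} + nS]. *)

Import GRing.Theory.

Set Implicit Arguments.
Unset Strict Implicit.
Unset Printing Implicit Defensive.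

Local Open Scope ring_scope.

(** * Sumsets and irreducible words *)

Section Sumsets.
Local Open Scope nat_scope.

Definition sumset (S : nat -> Prop) (n k : nat) : Prop :=
  exists w : seq nat, [/\ size w = n, {in w, forall s, S s} & sumn w = k].

Definition endpoint_sumset (g : nat) (S : nat -> Prop) (n k : nat) : Prop :=
  exists j l : nat, [/\ j = 0 \/ j = g, sumset S n l & k = j + l].

(** The equality [(n+1)S = {0, g} + nS]: the other inclusion is automatic when
    [0] and [g] belong to [S]. *)
Definition sumset_stable (g : nat) (S : nat -> Prop) (n : nat) : Prop :=
  forall k, sumset S n.+1 k -> endpoint_sumset g S n k.

(** A word of elements of [S] that witnesses that its sum is not in
    [endpoint_sumset]; keeping the word rather than its sum makes the notion
    pass to factors. *)
Definition irreducible_word (g : nat) (S : nat -> Prop) (w : seq nat) : Prop :=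
  {in w, forall s, S s} /\
  forall u, {in u, forall s, S s} -> size u = size w -> sumn u = sumn w ->
    0 \notin u /\ g \notin u.

Lemma not_stable_irreducible g (S : nat -> Prop) n :
  ~ sumset_stable g S n ->
  exists2 w, size w = n.+1 & irreducible_word g S w.
Proof.
move=> nst; apply: NNPP => nex; apply: nst => k [w [sw Sw wk]].
apply: NNPP => nend; apply: nex; exists w => //; split=> // u Su su uw.
have key j : j = 0 \/ j = g -> j \notin u.
  move=> hj; apply/negP => ju; apply: nend; exists j, (sumn (rem j u)).
  have pu := perm_to_rem ju; split => //.
    exists (rem j u); split=> //; first by rewrite size_rem // su sw.
    by move=> s /mem_rem /Su.
  by rewrite -wk -uw (perm_sumn pu).
by split; apply: key; [left | right].
Qed.

(** An exchange inside a factor is an exchange in the whole word. *)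
Lemma irreducible_infix g S u v w :
  irreducible_word g S (u ++ v ++ w) -> irreducible_word g S v.
Proof.
move=> [Sall irr]; split=> [s sv|v' Sv' sz sm].
  by apply: Sall; rewrite !mem_cat sv orbT.
have := irr (u ++ v' ++ w); rewrite !size_cat !sumn_cat sz sm.
case=> // [s|]; last by rewrite !mem_cat !negb_or => /and3P[_ -> _] /and3P[_ -> _].
rewrite !mem_cat => /or3P[su|/Sv' //|sw]; apply: Sall.
  by rewrite !mem_cat su.
by rewrite !mem_cat sw !orbT.
Qed.

Section Irreducible.
Variables (g : nat) (S : nat -> Prop).
Hypotheses (S0 : S 0) (Sg : S g) (S_le : forall s, S s -> s <= g).

Lemma irreducible_interior w s :
  irreducible_word g S w -> s \in w -> S s /\ 0 < s < g.
Proof.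
move=> [Sw irr] sw; have [n0 ng] := irr w Sw erefl erefl.
have Ss := Sw _ sw; split=> //; have := S_le Ss.
rewrite leq_eqVlt lt0n => /orP[/eqP es|->].
  by rewrite -es sw in ng.
by rewrite andbT; apply: contraNneq n0 => <-.
Qed.

Lemma sumn_bounds w : irreducible_word g S w -> size w <= sumn w <= size w * g.
Proof.
move=> irr.
have: {in w, forall s, 0 < s < g} by move=> s /(irreducible_interior irr)[].
elim: w {irr} => //= s w IH h.
have /andP[s0 sg] := h s (mem_head _ _).
have /andP[h1 h2]: size w <= sumn w <= size w * g.
  by apply: IH => t tw; apply: h; rewrite inE tw orbT.
by rewrite mulSn; lia.
Qed.

Lemma sumn_lt w : irreducible_word g S w -> 0 < size w -> sumn w < size w * g.
Proof.
case: w => //= s w irr _.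
have [_ /andP[_ sg]] := irreducible_interior irr (mem_head s w).
have irr' : irreducible_word g S w.
  by apply: (@irreducible_infix g S [:: s] w [::]); rewrite /= cats0.
by have := sumn_bounds irr'; rewrite mulSn; lia.
Qed.

(** The letters lie strictly between [0] and [g], so if the sum is [f + m g]
    then [m] is less than the length of the word: [f], [m] copies of [g] and
    zeros form a word of the same length and sum, which contains [0] or [g]
    as soon as the length is at least 2. *)
Lemma irreducible_sum_neq w f :
  irreducible_word g S w -> 1 < size w -> S f -> sumn w != f %[mod g].
Proof.
move=> irr sz2 Sf; apply/negP => eqm.
have fg := S_le Sf.
have lo := sumn_bounds irr.
have hi := sumn_lt irr (ltnW sz2).
(* The sum is positive, so it cannot be smaller than [f <= g] and congruent to it. *)
have fs : f <= sumn w.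
  rewrite leqNgt; apply/negP => lt.
  move: eqm; rewrite eq_sym (eqn_mod_dvd _ (ltnW lt)) => /dvdn_leq; lia.
move: eqm; rewrite eqn_mod_dvd // => /dvdnP[m hm].
have mlt : m < size w by nia.
set u := f :: nseq m g ++ nseq (size w - m.+1) 0.
have su : size u = size w by rewrite /u /= size_cat !size_nseq; lia.
have smu : sumn u = sumn w.
  by rewrite /u /= sumn_cat !sumn_nseq; lia.
have Su : {in u, forall s, S s}.
  by move=> s; rewrite inE mem_cat !mem_nseq => /or3P[/eqP->|/andP[_ /eqP->]|/andP[_ /eqP->]].
have [n0 ng] := irr.2 u Su su smu.
move: n0 ng; rewrite !inE !mem_cat !mem_nseq !eqxx !andbT !negb_or; lia.
Qed.

Lemma irreducible_sum_neq0 w :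
  irreducible_word g S w -> 0 < size w -> sumn w != 0 %[mod g].
Proof.
case: w => [|s [|t w]] // irr _; last exact: irreducible_sum_neq.
have [_ /andP[s0 sg]] := irreducible_interior irr (mem_head s [::]).
by rewrite /= addn0 mod0n modn_small // -lt0n.
Qed.

(** The difference of two prefix sums is the sum of a nonempty factor. *)
Lemma prefix_sums_neq w i j : irreducible_word g S w -> i < j <= size w ->
  sumn (take i w) != sumn (take j w) %[mod g].
Proof.
move=> irr /andP[ij jw].
have dec : take j w = take i w ++ drop i (take j w).
  by rewrite -{1}(cat_take_drop i (take j w)) (take_takel _ (ltnW ij)).
have irrv : irreducible_word g S (drop i (take j w)).
  apply: (@irreducible_infix g S (take i w) _ (drop j w)).
  by rewrite catA -dec cat_take_drop.
have sv : 0 < size (drop i (take j w)) by rewrite size_drop size_takel // subn_gt0.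
have neq := irreducible_sum_neq0 irrv sv.
rewrite [in sumn (take j w)]dec sumn_cat -[X in X != _ %[mod g]]addn0 eqn_modDl.
by rewrite eq_sym.
Qed.

Hypothesis g_gt0 : 0 < g.

Definition prefix_residue w (i : 'I_(size w).+1) : 'I_g :=
  Ordinal (ltn_pmod (sumn (take i w)) g_gt0).

Lemma prefix_residue_inj w : irreducible_word g S w -> injective (@prefix_residue w).
Proof.
move=> irr i j /(congr1 val) /= eqm; apply: val_inj => /=.
have [iw jw] : i <= size w /\ j <= size w by rewrite -ltnS -(ltnS j) !ltn_ord.
case: (ltngtP i j) => // lt.
  by have := @prefix_sums_neq w i j irr; rewrite lt jw eqm eqxx => /(_ isT).
by have := @prefix_sums_neq w j i irr; rewrite lt iw eqm eqxx => /(_ isT).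
Qed.

Lemma irreducible_size w : irreducible_word g S w -> size w < g.
Proof. by move=> /prefix_residue_inj /leq_card; rewrite !card_ord. Qed.

Lemma stable_pred : sumset_stable g S g.-1.
Proof.
apply: NNPP => /not_stable_irreducible[w sw /irreducible_size].
by rewrite sw prednK // ltnn.
Qed.

(** The [g] prefix sums represent each residue once.  The one congruent to [f]
    is not the empty sum because [0 < f < g], and not a sum of two or more
    letters by [irreducible_sum_neq]. *)
Lemma long_irreducible_prefix w f : irreducible_word g S w -> size w = g.-1 ->
  S f -> 0 < f < g -> f = head 0 w.
Proof.
move=> irr sw Sf /andP[f0 fg].
have [|inv _ Kinv] := inj_card_bij (prefix_residue_inj irr).
  by rewrite !card_ord sw prednK.
have /(congr1 val) /= := Kinv (Ordinal fg).
case: (inv _) => [i /= iw] eqm {inv Kinv}.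
have irri : irreducible_word g S (take i w).
  by apply: (@irreducible_infix g S [::] _ (drop i w)); rewrite /= cat_take_drop.
have szi : size (take i w) = i by rewrite size_takel.
case: i iw eqm irri szi => [|[|i]] iw eqm irri szi.
- by move: eqm f0; rewrite take0 mod0n => <-.
- move: eqm irri iw; case: {irr sw szi} w => //= s w; rewrite take0 /= addn0 => <- irri _.
  have [_ /andP[_ sg]] := irreducible_interior irri (mem_head s [::]).
  by rewrite modn_small.
- have := irreducible_sum_neq irri _ Sf; rewrite szi eqm modn_small // eqxx.
  by move=> /(_ isT).
Qed.

Lemma irreducible_three w : 1 < g -> irreducible_word g S w -> size w = g.-1 ->
  exists e, [/\ 0 < e < g, coprime e g & forall s, S s <-> [\/ s = 0, s = e | s = g]].
Proof.
move=> g1 irr sw; set e := head 0 w.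
have ew : e \in w by rewrite /e; case: w sw {irr e} => [/= sw|s w _]; [lia | rewrite /= mem_head].
have [Se e_int] := irreducible_interior irr ew.
exists e; split=> //; last first.
  move=> s; split=> [Ss|[]-> //].
  case: (posnP s) => [|s0]; first by constructor 1.
  case: (ltnP s g) => sg; last by constructor 3; have := S_le Ss; lia.
  by constructor 2; apply: (long_irreducible_prefix irr); rewrite ?s0.
have wE : w = nseq g.-1 e.
  rewrite -sw; apply/all_pred1P/allP => s swm /=.
  have [Ss s_int] := irreducible_interior irr swm.
  by apply/eqP; apply: (long_irreducible_prefix irr).
(* With [d = gcd e g > 1], the prefix of length [g / d] would sum to a multiple of [g]. *)
rewrite /coprime; set d := gcdn e g.
have d0 : 0 < d by rewrite gcdn_gt0 g_gt0 orbT.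
apply/negPn/negP => dn1; have d1 : 1 < d by lia.
have [de dg] := (dvdn_gcdl e g : d %| e, dvdn_gcdr e g : d %| g).
have qg : g %/ d < g by apply: ltn_Pdiv.
have q0 : 0 < g %/ d by rewrite divn_gt0 // dvdn_leq.
have := @prefix_sums_neq w 0 (g %/ d) irr.
rewrite q0 sw wE take0 take_nseq; last by lia.
have -> : g %/ d <= g.-1 by lia.
by rewrite sumn_nseq muln_divA // -divn_mulAC // modnMl /= mod0n => /(_ isT).
Qed.

End Irreducible.

Lemma sumn_three_modn g e w : {in w, forall s, [\/ s = 0, s = e | s = g]} ->
  exists2 c, c <= size w & sumn w = c * e %[mod g].
Proof.
elim: w => [|s w IH] h; first by exists 0.
have [|c cw ec] := IH; first by move=> t tw; apply: h; rewrite inE tw orbT.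
case: (h s (mem_head _ _)) => ->.
- by exists c; first exact: leqW.
- by exists c.+1 => //=; rewrite mulSn -modnDmr ec modnDmr.
- by exists c; [exact: leqW | rewrite /= modnDl].
Qed.

(** The witness is the sum [(n+1)e]: rewriting it with an endpoint leaves at
    most [n] copies of [e] modulo [g]. *)
Lemma three_stable_ge g e (S : nat -> Prop) n : 0 < g -> coprime e g ->
  (forall s, S s <-> [\/ s = 0, s = e | s = g]) ->
  sumset_stable g S n -> g.-1 <= n.
Proof.
move=> g0 cop SE /(_ (n.+1 * e)) [].
  exists (nseq n.+1 e); split; rewrite ?size_nseq ?sumn_nseq ?(mulnC e) //.
  by move=> s; rewrite mem_nseq => /andP[_ /eqP->]; apply/SE; constructor 2.
move=> j [l [hj [w [sw Sw <-]] eqs]].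
have [|c cw ec] := @sumn_three_modn g e w; first by move=> s /Sw /SE.
have eqm : n.+1 * e == c * e %[mod g].
  by rewrite eqs; case: hj => ->; rewrite ?modnDl ?add0n ec.
rewrite sw in cw.
move: eqm; rewrite eqn_mod_dvd ?leq_mul2r ?(leqW cw) ?orbT // -mulnBl.
rewrite Gauss_dvdl 1?coprime_sym // => /dvdn_leq; lia.
Qed.

Theorem maximal_reduction_sumset g (S : nat -> Prop) : 0 < g -> S 0 -> S g ->
  (forall s, S s -> s <= g) ->
  (sumset_stable g S (g - 1) /\ forall n, sumset_stable g S n -> g - 1 <= n) <->
  g = 1 \/ exists e, [/\ 0 < e < g, coprime e g &
                       forall s, S s <-> [\/ s = 0, s = e | s = g]].
Proof.
move=> g0 S0 Sg S_le; rewrite subn1.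
have stab := stable_pred S0 Sg S_le g0.
split=> [[_ min]|[g1|[e [_ cop SE]]]]; last first.
- by split=> // n; apply: three_stable_ge cop SE.
- by split=> // n _; rewrite g1.
case: (ltnP 1 g) => g1; [right | by left; lia].
have /not_stable_irreducible[w sw irr] : ~ sumset_stable g S g.-2.
  by move=> /min; lia.
by apply: (irreducible_three S0 Sg S_le g0 g1 irr); lia.
Qed.

End Sumsets.

(** * Ideals given by generators *)

Section IdealGenerators.
Variable R : comNzRingType.
Implicit Types (S T I J : R -> Prop) (f u v : R).

Lemma ideal_gen_incl S u : S u -> ideal_gen S u.
Proof.
move=> Su; exists 1%N, (fun=> 1), (fun=> u); split=> //.
by rewrite big_ord1 mul1r.
Qed.

Lemma ideal_gen0 S : ideal_gen S 0.
Proof. by exists 0%N, (fun=> 0), (fun=> 0); split=> [[]//|]; rewrite big_ord0. Qed.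

Lemma ideal_genM S f u : ideal_gen S u -> ideal_gen S (f * u).
Proof.
move=> [n [c [s [Ss ->]]]]; exists n, (fun i => f * c i), s; split=> //.
by rewrite mulr_sumr; apply: eq_bigr => i _; rewrite mulrA.
Qed.

Lemma ideal_genD S u v : ideal_gen S u -> ideal_gen S v -> ideal_gen S (u + v).
Proof.
move=> [n [c [s [Ss ->]]]] [m [d [t [St ->]]]].
exists (n + m)%N, (fun i => match split i with inl j => c j | inr j => d j end),
  (fun i => match split i with inl j => s j | inr j => t j end); split.
  by move=> i; case: (split i).
rewrite big_split_ord /=; congr (_ + _); apply: eq_bigr => i _.
  by rewrite (unsplitK (inl _ i)).
by rewrite (unsplitK (inr _ i)).
Qed.

Lemma ideal_gen_min S T : (forall u, S u -> ideal_gen T u) ->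
  forall f, ideal_gen S f -> ideal_gen T f.
Proof.
move=> ST f [n [c [s [Ss ->]]]]; apply: big_ind => [|u v|i _].
- exact: ideal_gen0.
- exact: ideal_genD.
- exact/ideal_genM/ST.
Qed.

Lemma ideal_gen_ext S T : set_eq S T -> set_eq (ideal_gen S) (ideal_gen T).
Proof.
by move=> ST f; split; apply: ideal_gen_min => u /ST; apply: ideal_gen_incl.
Qed.

Lemma ideal_mul_ext I I' J J' : set_eq I I' -> set_eq J J' ->
  set_eq (ideal_mul I J) (ideal_mul I' J').
Proof.
move=> hI hJ; apply: ideal_gen_ext => f.
by split=> -[u [v [/hI Iu [/hJ Jv ->]]]]; exists u, v.
Qed.

Lemma ideal_mul_gen S T : set_eq (ideal_mul (ideal_gen S) (ideal_gen T))
  (ideal_gen (fun f => exists u v, S u /\ T v /\ f = u * v)).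
Proof.
move=> f; split; apply: ideal_gen_min => _ [u [v [Su [Tv ->]]]]; last first.
  by apply: ideal_gen_incl; exists u, v; do !split=> //; apply: ideal_gen_incl.
case: Su => n [c [s [Ss ->]]]; case: Tv => m [d [t [Tt ->]]].
rewrite mulr_suml; apply: big_ind => [|? ?|i _]; [exact: ideal_gen0 | exact: ideal_genD |].
rewrite mulr_sumr; apply: big_ind => [|? ?|j _]; [exact: ideal_gen0 | exact: ideal_genD |].
rewrite mulrACA; apply/ideal_genM/ideal_gen_incl.
by exists (s i), (t j).
Qed.

Lemma ideal_exp_ext I J r : set_eq I J -> set_eq (ideal_exp I r) (ideal_exp J r).
Proof. by move=> IJ; elim: r => //= r IH; apply: ideal_mul_ext. Qed.

Lemma set_eq_trans I J T : set_eq I J -> set_eq J T -> set_eq I T.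
Proof. by move=> IJ JT f; rewrite IJ JT. Qed.

Lemma set_eq_sym I J : set_eq I J -> set_eq J I.
Proof. by move=> IJ f; rewrite IJ. Qed.

End IdealGenerators.

(** * Monomials in two variables *)

Section Monomials.
Variable K : fieldType.

Definition exponent (c d : nat) : 'X_{1..2} :=
  (U_(0%R : 'I_2) *+ c + U_(1%R : 'I_2) *+ d)%MM.

Lemma monE c d : mon K c d = 'X_[exponent c d].
Proof. by rewrite /mon !mpolyXn -mpolyXD. Qed.

Lemma exponentE c d : exponent c d (0%R : 'I_2) = c /\ exponent c d (1%R : 'I_2) = d.
Proof. by rewrite !mnmDE !mulmnE !mnm1E /= !mul1n !mul0n addn0. Qed.

Lemma mon_inj c d c' d' : mon K c d = mon K c' d' -> c = c' /\ d = d'.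
Proof.
rewrite !monE => /(congr1 (mcoeff (exponent c d))).
rewrite !mcoeffX eqxx; case: eqP => [em _|_ /eqP]; last by rewrite oner_eq0.
have [ec ed] := exponentE c d; have [ec' ed'] := exponentE c' d'.
by split; [rewrite -[LHS]ec -em | rewrite -[LHS]ed -em].
Qed.

Lemma mulmon c d c' d' : mon K c d * mon K c' d' = mon K (c + c') (d + d').
Proof. by rewrite /mon mulrACA -!exprD. Qed.

(** In an expression [x^c y^d = \sum_i f_i s_i] with monomials [s_i], the
    coefficient at [(c, d)] of some [f_i s_i] is nonzero, so [s_i] divides
    [x^c y^d]. *)
Lemma mon_in_ideal_gen (G : {mpoly K[2]} -> Prop) c d :
  (forall u, G u -> exists c' d', u = mon K c' d') ->
  ideal_gen G (mon K c d) ->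
  exists c' d', [/\ G (mon K c' d'), (c' <= c)%N & (d' <= d)%N].
Proof.
move=> Gmon [n [f [s [Gs eqs]]]].
have /existsP[i supp_i] : [exists i, exponent c d \in msupp (f i * s i)].
  apply: contraT; rewrite negb_exists => /forallP nosupp.
  have /(congr1 (mcoeff (exponent c d))) := eqs.
  rewrite monE mcoeffX eqxx raddf_sum big1 => [/eqP|i _].
    by rewrite oner_eq0.
  by apply/eqP; have := nosupp i; rewrite mcoeff_msupp negbK.
have [c' [d' es]] := Gmon _ (Gs i); exists c', d'.
move: supp_i (Gs i); rewrite es monE (perm_mem (msuppMX _ _)) => /mapP[m' _ em] Gi.
have [ec ed] := exponentE c d; have [ec' ed'] := exponentE c' d'.
split=> //.
  by rewrite -[leqRHS]ec em mnmDE ec' leq_addr.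
by rewrite -[leqRHS]ed em mnmDE ed' leq_addr.
Qed.

End Monomials.

(** * Ideals generated on a line, and sumsets *)

Section LineIdeals.
Variables (K : fieldType) (p q g : nat).
Hypotheses (p_gt0 : (0 < p)%N) (q_gt0 : (0 < q)%N).

(** The [k]-th lattice point, counted from the pure power of [y], of the
    segment joining [y^(n g q)] to [x^(n g p)]. *)
Definition line_mon (n k : nat) : {mpoly K[2]} := mon K (k * p) ((n * g - k) * q).

Definition line_gens (n : nat) (T : nat -> Prop) : {mpoly K[2]} -> Prop :=
  fun u => exists2 k, T k & u = line_mon n k.

Lemma line_monM n m k l : (k <= n * g)%N -> (l <= m * g)%N ->
  line_mon n k * line_mon m l = line_mon (n + m) (k + l).
Proof.
move=> kn lm; rewrite mulmon -!mulnDl; congr (mon _ _ (_ * _)%N).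
by rewrite mulnDl; lia.
Qed.

(** Along the line the two exponents vary in opposite directions, so no
    monomial on it divides another one. *)
Lemma line_gensP n T k : (k <= n * g)%N -> ideal_gen (line_gens n T) (line_mon n k) <-> T k.
Proof.
move=> kn; split=> [|Tk]; last by apply: ideal_gen_incl; exists k.
move=> /mon_in_ideal_gen[u [l _ ->]|c [d [[l Tl el] lc ld]]]; first by do 2!eexists.
have [ec ed] := mon_inj el; move: lc ld; rewrite ec ed !leq_pmul2r // => lk kl.
by have -> : k = l by lia.
Qed.

Lemma line_gens_mul n m S T (P : nat -> Prop) :
  (forall k, S k -> k <= n * g)%N -> (forall l, T l -> l <= m * g)%N ->
  (forall h, P h <-> exists k l, [/\ S k, T l & h = (k + l)%N]) ->
  set_eq (ideal_mul (ideal_gen (line_gens n S)) (ideal_gen (line_gens m T)))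
         (ideal_gen (line_gens (n + m) P)).
Proof.
move=> Sn Tm PE; apply: set_eq_trans (ideal_mul_gen _ _) _.
apply: ideal_gen_ext => f; split.
  move=> [_ [_ [[k Sk ->] [[l Tl ->] ->]]]]; exists (k + l)%N.
    by apply/PE; exists k, l.
  by rewrite line_monM //; [apply: Sn | apply: Tm].
move=> [_ /PE[k [l [Sk Tl ->]]] ->]; exists (line_mon n k), (line_mon m l).
split; first by exists k.
split; first by exists l.
by rewrite line_monM //; [apply: Sn | apply: Tm].
Qed.

Lemma sumset_le (S : nat -> Prop) n k : (forall s, S s -> s <= g)%N ->
  sumset S n k -> (k <= n * g)%N.
Proof.
move=> S_le [w [<- Sw <-]]; elim: w Sw => //= s w IH Sw; rewrite mulSn leq_add //.
  by apply/S_le/Sw/mem_head.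
by apply: IH => t tw; apply: Sw; rewrite inE tw orbT.
Qed.

Lemma sumsetS (S : nat -> Prop) n h :
  sumset S n.+1 h <-> exists k l, [/\ S k, sumset S n l & h = (k + l)%N].
Proof.
split=> [[[|k w] [//= [sw] Sw <-]]|[k [_ [Sk [w [<- Sw <-]] ->]]]].
  exists k, (sumn w); split=> //; first exact/Sw/mem_head.
  by exists w; split=> // t tw; apply: Sw; rewrite inE tw orbT.
by exists (k :: w); split=> // t; rewrite inE => /predU1P[->|/Sw].
Qed.

Lemma ideal_exp_line (S : nat -> Prop) n : (forall s, S s -> s <= g)%N ->
  set_eq (ideal_exp (ideal_gen (line_gens 1 S)) n)
         (ideal_gen (line_gens n (sumset S n))).
Proof.
move=> S_le; elim: n => [|n IH].
  move=> f; split=> // _; rewrite -[f]mulr1; apply/ideal_genM/ideal_gen_incl.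
  exists 0%N; first by exists [::].
  by rewrite /line_mon /mon !expr0 mulr1.
apply: set_eq_trans (ideal_mul_ext (fun=> iff_refl _) IH) _.
apply: (@line_gens_mul 1 n) => [s /S_le|l|h]; first by rewrite mul1n.
  exact: sumset_le.
exact: sumsetS.
Qed.

Lemma line_endpoints :
  set_eq (ideal_seq [:: mon K (g * p) 0; mon K 0 (g * q)])
         (ideal_gen (line_gens 1 (fun k => k = 0 \/ k = g)%N)).
Proof.
apply: ideal_gen_ext => u; rewrite !inE; split.
  case/orP => /eqP ->; [exists g; first by right | exists 0%N; first by left];
    by rewrite /line_mon mul1n ?subnn ?subn0 ?mul0n.
by move=> [_ [->|->] ->]; rewrite /line_mon mul1n ?subnn ?subn0 ?mul0n eqxx ?orbT.
Qed.

Lemma power_eq_iff_stable (S : nat -> Prop) n : S 0%N -> S g ->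
  (forall s, S s -> s <= g)%N ->
  let I := ideal_gen (line_gens 1 S) in
  let J := ideal_seq [:: mon K (g * p) 0; mon K 0 (g * q)] in
  set_eq (ideal_exp I n.+1) (ideal_mul J (ideal_exp I n)) <-> sumset_stable g S n.
Proof.
move=> S0 Sg S_le I J.
have IE := ideal_exp_line n.+1 S_le.
have JE : set_eq (ideal_mul J (ideal_exp I n))
                 (ideal_gen (line_gens n.+1 (endpoint_sumset g S n))).
  apply: set_eq_trans (ideal_mul_ext line_endpoints (ideal_exp_line n S_le)) _.
  apply: (@line_gens_mul 1 n) => [k [] ->|l|h] //; first by rewrite mul1n.
  exact: sumset_le.
split=> [eqIJ k Sk|stab].
  have kn := sumset_le S_le Sk.
  by apply/(line_gensP _ kn)/JE/eqIJ/IE/(line_gensP _ kn).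
apply: (set_eq_trans IE); apply: set_eq_trans _ (set_eq_sym JE).
apply: ideal_gen_ext => u; split=> -[k hk ->]; exists k => //; first exact: stab.
by case: hk => j [l [hj Sl ->]]; apply/sumsetS; exists j, l; split=> //; case: hj => ->.
Qed.

Lemma reduction_number_stable (S : nat -> Prop) I r : S 0%N -> S g ->
  (forall s, S s -> s <= g)%N -> set_eq I (ideal_gen (line_gens 1 S)) ->
  is_reduction_number (ideal_seq [:: mon K (g * p) 0; mon K 0 (g * q)]) I r <->
  sumset_stable g S r /\ forall n, sumset_stable g S n -> (r <= n)%N.
Proof.
move=> S0 Sg S_le IE; set J := ideal_seq _.
have eqP n : set_eq (ideal_exp I n.+1) (ideal_mul J (ideal_exp I n)) <-> sumset_stable g S n.
  rewrite -(power_eq_iff_stable n S0 Sg S_le) -/J.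
  have E1 := ideal_exp_ext n.+1 IE.
  have E2 := ideal_mul_ext (fun=> iff_refl _) (ideal_exp_ext n IE) : set_eq (ideal_mul J _) _.
  split=> h; first exact: set_eq_trans (set_eq_sym E1) (set_eq_trans h E2).
  exact: set_eq_trans E1 (set_eq_trans h (set_eq_sym E2)).
by split=> -[/eqP h min]; split=> // n /eqP /min.
Qed.

Lemma line_three e : (e <= g)%N ->
  set_eq (ideal_seq [:: mon K (g * p) 0; mon K (e * p) (g * q - e * q); mon K 0 (g * q)])
         (ideal_gen (line_gens 1 (fun k => [\/ k = 0, k = e | k = g]%N))).
Proof.
move=> eg; apply: ideal_gen_ext => u; rewrite !inE -mulnBl; split.
  case/or3P => /eqP ->; [exists g; first by constructor 3 |
    exists e; first by constructor 2 | exists 0%N; first by constructor 1];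
    by rewrite /line_mon mul1n ?subnn ?subn0 ?mul0n.
by move=> [_ [->|->|->] ->]; rewrite /line_mon mul1n ?subnn ?subn0 ?mul0n eqxx ?orbT.
Qed.

(** After division by [g] the equation reads [q c + p d = g p q], so that [p]
    divides [c] by Gauss. *)
Lemma line_points c d : coprime p q -> (g * q * c + g * p * d = g * p * (g * q))%N ->
  (0 < g)%N -> exists2 k, (k <= g)%N & mon K c d = line_mon 1 k.
Proof.
move=> cop eqcd g0.
have {}eqcd : (q * c + p * d = p * (g * q))%N.
  by apply/eqP; rewrite -(eqn_pmul2l g0) mulnDr !mulnA eqcd; apply/eqP; lia.
have /dvdnP[k ec] : (p %| c)%N.
  rewrite -(Gauss_dvdr _ cop) -(dvdn_addl _ (dvdn_mulr d (dvdnn p))) eqcd.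
  exact: dvdn_mulr.
have ed : (q * k + d = g * q)%N.
  by apply/eqP; rewrite -(eqn_pmul2l p_gt0) -eqcd ec mulnDr; apply/eqP; lia.
have kg : (k <= g)%N by rewrite -(leq_pmul2r q_gt0); lia.
by exists k => //; rewrite /line_mon ec mul1n mulnBl; congr (mon _ _ _); lia.
Qed.

End LineIdeals.

(** * Maximal reduction number *)

Unset Implicit Arguments.

Theorem theorem3p4 (K : fieldType) (a b : nat) (ha : (1 <= a)%N) (hb : (1 <= b)%N)
    (I : {mpoly K[2]} -> Prop) (hI : class_I1 a b I) :
  let g := gcdn a b in
  is_reduction_number (ideal_seq [:: mon K a 0; mon K 0 b]) I (g - 1)%N <->
  (g = 1%N /\ set_eq I (ideal_seq [:: mon K a 0; mon K 0 b])) \/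
  (exists e : nat, [/\ (1 <= e <= g - 1)%N, gcdn e g = 1%N
     & set_eq I (ideal_seq [:: mon K a 0;
                               mon K (e * (a %/ g)) (b - e * (b %/ g));
                               mon K 0 b])]).
Proof.
move=> g; have g0 : (0 < g)%N by rewrite gcdn_gt0 ha.
set p := (a %/ g)%N; set q := (b %/ g)%N.
have aE : a = (g * p)%N by rewrite mulnC divnK ?dvdn_gcdl.
have bE : b = (g * q)%N by rewrite mulnC divnK ?dvdn_gcdr.
have p0 : (0 < p)%N by rewrite divn_gt0 // dvdn_leq ?dvdn_gcdl.
have q0 : (0 < q)%N by rewrite divn_gt0 // dvdn_leq ?dvdn_gcdr.
have cop : coprime p q.
  by rewrite /coprime -(eqn_pmul2l g0) muln1 muln_gcdr -aE -bE.
clearbody p q g; subst a b; clear ha hb.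
have [G [[Gmon IG _] Ga Gb Gline]] := hI.
pose S k := (k <= g)%N /\ G (line_mon K p q g 1 k).
have S0 : S 0%N by split=> //; rewrite /line_mon mul1n subn0.
have Sg : S g by split=> //; rewrite /line_mon mul1n subnn.
have S_le s : S s -> (s <= g)%N by case.
have IS : set_eq I (ideal_gen (line_gens p q g 1 S)).
  apply: set_eq_trans IG _; apply: ideal_gen_ext => u; split=> [Gu|[k [_ Gk] -> //]].
  have [c [d eu]] := Gmon u Gu.
  rewrite eu in Gu *.
  have [k kg ek] := line_points K p0 q0 cop (Gline c d Gu) g0.
  by exists k => //; split=> //; rewrite -ek.
split.
  move=> /(reduction_number_stable p0 q0 _ S0 Sg S_le IS).
  move=> /(maximal_reduction_sumset g0 S0 Sg S_le)[g1|[e [e_int ecop SE]]].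
    left; split=> //; apply: set_eq_trans IS (set_eq_sym _).
    apply: set_eq_trans (line_endpoints p q g) _.
    apply: ideal_gen_ext => u; split=> -[k hk ->]; exists k => //; first by case: hk => ->.
    by have := S_le k hk; rewrite g1; lia.
  right; exists e; split; [lia | exact/eqP |].
  have eg : (e <= g)%N by lia.
  apply: set_eq_trans IS (set_eq_trans _ (set_eq_sym (line_three p q eg))).
  by apply: ideal_gen_ext => u; split=> -[k hk ->]; exists k => //; apply/SE.
case=> [[g1 _]|[e [e_int /eqP ecop Ie]]].
  apply/(reduction_number_stable p0 q0 _ S0 Sg S_le IS).
  by apply/(maximal_reduction_sumset g0 S0 Sg S_le); left.
have eg : (e <= g)%N by lia.
have {}Ie := set_eq_trans Ie (line_three p q eg).
set T := (fun k => _) in Ie.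
have T0 : T 0%N by constructor 1.
have Tg : T g by constructor 3.
have T_le s : T s -> (s <= g)%N by case=> ->.
apply/(reduction_number_stable p0 q0 _ T0 Tg T_le Ie).
apply/(maximal_reduction_sumset g0 T0 Tg T_le); right.
by exists e; split=> //; lia.
Qed.
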